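(* Let $M$ be a connected matroid of rank $d$ on the ground set $[n]$ with $n\geq 2$. Each facet of the matroid polytope $P(M)$ is either defined by the $F$-hyperplane for some flat $F$ of $M$ with $0<\operatorname{rk}(F)<\#F$, or it is induced by one of the facets of the hypersimplex $\Delta(d,n)$. In particular, the facets of $P(M)$ are either induced by splits of the hypersimplex $\Delta(d,n)$ (i.e. cut out by a hyperplane which is the split hyperplane of a split of $\Delta(d,n)$) or by facets of the hypersimplex $\Delta(d,n)$.
   Context: The matroid polytope $P(M)\subset\mathbb{R}^n$ is the convex hull of the characteristic vectors of the bases of $M$. The hypersimplex is $\Delta(d,n)=P(U_{d,n})=[0,1]^n\cap\{\sum_i x_i=d\}$; it contains $P(M)$. The rank function of $M$ is denoted $\operatorname{rk}$. For a flat $F$ of $M$ the $F$-hyperplane is given by $(d-\operatorname{rk}(F))\sum_{i\in F}x_i=\operatorname{rk}(F)\sum_{j\notin F}x_j$; on the affine hyperplane $\sum_i x_i=d$ this is equivalent to $\sum_{i\in F}x_i=\operatorname{rk}(F)$. A facet $\Phi$ of $P(M)$ is defined by a hyperplane $H$ if $\Phi=P(M)\cap H$, and it is induced by a facet $\Psi$ of $\Delta(d,n)$ if $\Phi=P(M)\cap\Psi$. A split of a polytope $P$ is a polytopal subdivision of $P$ (without new vertices) with exactly two maximal cells; the affine span of the common codimension-one cell of these two cells is the split hyperplane (considered within the affine hull of $P$). *)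

(* Defs.v *)
From mathcomp Require Import all_boot all_order all_algebra.
From mathcomp Require Import boolp classical_sets functions cardinality reals.

Set Implicit Arguments.
Unset Strict Implicit.
Unset Printing Implicit Defensive.

Import Order.TTheory GRing.Theory Num.Theory.

Local Open Scope ring_scope.
Local Open Scope classical_set_scope.

Record matroid (n : nat) := Matroid {
  bases : {set {set 'I_n}};
  bases_neq0 : bases != finset.set0;
  basis_exchange : forall B1 B2 : {set 'I_n}, B1 \in bases -> B2 \in bases ->
    forall x : 'I_n, x \in (B1 :\: B2)%SET ->
    exists2 y : 'I_n, y \in (B2 :\: B1)%SET & (y |: (B1 :\ x))%SET \in bases
}.

Section Matroid.
Variables (n : nat) (M : matroid n).

Definition independent (I : {set 'I_n}) : bool :=
  [exists B in bases M, I \subset B].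

Definition rk (A : {set 'I_n}) : nat :=
  \max_(I : {set 'I_n} | independent I && (I \subset A)) #|I|.

Definition matroid_rank : nat := rk [set: 'I_n]%SET.

Definition flat (F : {set 'I_n}) : bool :=
  [forall x : 'I_n, (x \notin F) ==> (rk F < rk (x |: F)%SET)%N].

Definition circuit (C : {set 'I_n}) : bool :=
  minset (fun A : {set 'I_n} => ~~ independent A) C.

Definition matroid_connected : Prop :=
  forall x y : 'I_n, x != y ->
  exists C : {set 'I_n}, [/\ circuit C, x \in C & y \in C].

End Matroid.

Section Polytope.
Variables (R : realType) (n : nat).
Implicit Types (A P Q C D F H : set 'rV[R]_n) (Sigma : set (set 'rV[R]_n)).

Definition conv_hull A : set 'rV[R]_n :=
  [set x | exists (k : nat) (p : 'I_k -> 'rV[R]_n) (a : 'I_k -> R),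
     [/\ forall i, A (p i), forall i, 0 <= a i, \sum_i a i = 1
       & x = \sum_i a i *: p i]].

Definition aff_hull A : set 'rV[R]_n :=
  [set x | exists (k : nat) (p : 'I_k -> 'rV[R]_n) (a : 'I_k -> R),
     [/\ forall i, A (p i), \sum_i a i = 1 & x = \sum_i a i *: p i]].

Definition affinely_independent (k : nat) (p : 'I_k -> 'rV[R]_n) : Prop :=
  forall a : 'I_k -> R,
    \sum_i a i = 0 -> \sum_i a i *: p i = 0 -> forall i, a i = 0.

(* The largest number of affinely independent points of A, that is, the
   dimension of A PLUS ONE; it is 0 exactly when A is empty (dimension -1). *)
Definition affdimS A : nat :=
  \max_(k < n.+2 | `[< exists p : 'I_k -> 'rV[R]_n,
                        (forall i, A (p i)) /\ affinely_independent p >]) k.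

Definition polytope P : Prop :=
  exists V : set 'rV[R]_n, finite_set V /\ P = conv_hull V.

(* The linear form may be zero: P itself and the empty set are faces of P. *)
Definition face P F : Prop :=
  exists (c : 'rV[R]_n) (b : R),
    (forall x, P x -> \sum_i c 0 i * x 0 i <= b) /\
    F = P `&` [set x | \sum_i c 0 i * x 0 i = b].

Definition facet P F : Prop := face P F /\ (affdimS F).+1 = affdimS P.

Definition vertex P (v : 'rV[R]_n) : Prop := face P [set v].

Definition polytopal_complex Sigma : Prop :=
  [/\ finite_set Sigma,
      forall C, Sigma C -> polytope C,
      forall C F, Sigma C -> face C F -> Sigma F
    & forall C D, Sigma C -> Sigma D -> face C (C `&` D) /\ face D (C `&` D)].

(* The last clause says that the subdivision has no new vertices. *)
Definition subdivision P Sigma : Prop :=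
  [/\ polytopal_complex Sigma,
      \bigcup_(C in Sigma) C = P
    & forall C v, Sigma C -> vertex C v -> vertex P v].

Definition maximal_cell Sigma C : Prop :=
  Sigma C /\ forall D, Sigma D -> C `<=` D -> D = C.

(* Sigma is a split of P, with C and D as its two maximal cells. *)
Definition split_with_cells P Sigma C D : Prop :=
  [/\ subdivision P Sigma, C <> D
    & forall Q, maximal_cell Sigma Q <-> Q = C \/ Q = D].

(* A split hyperplane is a hyperplane relative to the affine hull of P; for a
   polytope that is not full-dimensional it is not a hyperplane of R^n. *)
Definition split_hyperplane P H : Prop :=
  exists Sigma C D,
    [/\ split_with_cells P Sigma C D,
        (affdimS (C `&` D)).+1 = affdimS P
      & H = aff_hull (C `&` D)].

End Polytope.

Section MatroidPolytope.
Variables (R : realType) (n : nat).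

Definition char_vec (B : {set 'I_n}) : 'rV[R]_n := \row_i (i \in B)%:R.

Definition matroid_polytope (M : matroid n) : set 'rV[R]_n :=
  conv_hull [set x | exists2 B, B \in bases M & x = char_vec B].

Definition hypersimplex (d : nat) : set 'rV[R]_n :=
  [set x | (forall i, 0 <= x 0 i <= 1) /\ \sum_i x 0 i = d%:R].

(* For F the whole ground set the equation is trivial (0 = 0). *)
Definition flat_hyperplane (M : matroid n) (F : {set 'I_n}) : set 'rV[R]_n :=
  [set x | ((matroid_rank M)%:R - (rk M F)%:R) * (\sum_(i in F) x 0 i) =
           (rk M F)%:R * (\sum_(j | j \notin F) x 0 j)].

End MatroidPolytope.

Arguments char_vec R {n} B.
Arguments matroid_polytope R {n} M.
Arguments hypersimplex : clear implicits.
Arguments flat_hyperplane R {n} M F.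

(* Main.v *)
(** A facet of P(M) is cut out by a linear form c, and by basis exchange every
   c-maximal basis B satisfies #|B :&: S| = rk S for every level set
   S = {i | t < c i}. If c took three values, two nested level sets together with
   the equation sum x = d would leave dimension at most n - 3; hence c has exactly
   two values, and the facet lies on x(S) = rk S. The same dimension count shows
   that S is a flat unless the facet is x_i = 0, and that rk S < #|S| unless
   it is x_i = 1. Connectedness only enters through dim P(M) = n - 1: two elements
   of a circuit are exchanged between two bases. For the split, the two cells are
   the halves of the hypersimplex cut by x(F) = rk F; each is the convex hull of
   its 0/1 points, since two fractional coordinates can be shifted against each
   other until one of them becomes integral. *)
Require Import Defs.
From mathcomp Require Import all_boot all_order all_algebra.
From mathcomp Require Import boolp classical_sets functions cardinality reals.
From mathcomp Require Import ring.

Set Implicit Arguments.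
Unset Strict Implicit.
Unset Printing Implicit Defensive.

Import Order.TTheory GRing.Theory Num.Theory.

Local Open Scope ring_scope.
Local Open Scope classical_set_scope.

(** * Bases and rank of a matroid *)

Section MatroidTheory.
Variables (n : nat) (M : matroid n).
Import mathcomp.boot.bigop mathcomp.boot.fintype mathcomp.boot.finset.
Local Open Scope nat_scope.
Local Open Scope set_scope.
Implicit Types (A B I J S C : {set 'I_n}) (x y z : 'I_n).

Lemma basesP : exists B, B \in bases M.
Proof. exact/set0Pn/bases_neq0. Qed.

Lemma indepP I :
  reflect (exists2 B, B \in bases M & I \subset B) (independent M I).
Proof. exact: (iffP exists_inP). Qed.

Lemma basis_indep B : B \in bases M -> independent M B.
Proof. by move=> BM; apply/indepP; exists B. Qed.

Lemma indepS I J : J \subset I -> independent M I -> independent M J.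
Proof.
move=> JI /indepP[B BM IB]; apply/indepP; exists B => //.
exact: subset_trans IB.
Qed.

(** Exchanging an element of [B1 :\: B2] for one of [B2 :\: B1] keeps the cardinality and shrinks
    the difference, until [B1] lies inside [B2]. *)
Lemma card_basis_le B1 B2 : B1 \in bases M -> B2 \in bases M -> #|B1| <= #|B2|.
Proof.
have [m] := ubnP #|B1 :\: B2|; elim: m B1 => // m IH B1 /[!ltnS] leB B1M B2M.
have [/eqP|[x xB]] := set_0Vmem (B1 :\: B2).
  by rewrite setD_eq0; apply: subset_leq_card.
have [y yB BM'] := basis_exchange B1M B2M xB.
move: xB yB; rewrite !in_setD => /andP[xB2 xB1] /andP[yB1 yB2].
have yx : y \notin B1 :\ x by rewrite !inE (negPf yB1) andbF.
suff lt : #|(y |: B1 :\ x) :\: B2| < m.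
  by have := IH _ lt BM' B2M; rewrite cardsU1 yx (cardsD1 x B1) xB1.
apply: leq_trans leB; apply: proper_card; apply/properP; split.
  apply/subsetP => z; rewrite !inE => /andP[zB2 /orP[/eqP zy|/andP[_ ->]]].
    by rewrite zy yB2 in zB2.
  by rewrite zB2.
exists x; rewrite !inE ?xB2 ?xB1 //= eqxx /= orbF.
by apply: contraNneq xB2 => ->.
Qed.

Lemma card_basis B : B \in bases M -> #|B| = matroid_rank M.
Proof.
move=> BM; apply/eqP; rewrite eqn_leq; apply/andP; split.
  by apply: (bigmax_sup B); rewrite ?basis_indep ?subsetT.
apply/bigmax_leqP => I /andP[/indepP[B' B'M /subset_leq_card IB'] _].
exact: leq_trans IB' (card_basis_le _ _).
Qed.

(** Start from any basis containing [I] and trade its elements outside [I :|: B] for elements of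
    [B]; elements of [I] are never traded away. *)
Lemma basis_between I B : independent M I -> B \in bases M ->
  exists B', [/\ B' \in bases M, I \subset B' & B' \subset I :|: B].
Proof.
move=> /indepP[B1 + +] BM.
have [m] := ubnP #|B1 :\: (I :|: B)|; elim: m B1 => // m IH B1 /[!ltnS] leB B1M IB1.
have [/eqP|[x]] := set_0Vmem (B1 :\: (I :|: B)).
  by rewrite setD_eq0; exists B1.
rewrite !inE negb_or => /andP[/andP[xI xB] xB1].
have xB1B : x \in B1 :\: B by rewrite !inE xB.
have [y] := basis_exchange B1M BM xB1B; rewrite !inE => /andP[yB1 yB] BM'.
apply: IH BM' _; last first.
  apply/subsetP => z zI; rewrite !inE (subsetP IB1) // andbT.
  by apply/orP; right; apply: contraNneq xI => <-.
apply: leq_trans leB; apply: proper_card; apply/properP; split.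
  apply/subsetP => z; rewrite !inE negb_or.
  case/andP=> /andP[-> zB] /orP[/eqP zy|/andP[_ ->]]; last by rewrite zB.
  by rewrite zy yB in zB.
exists x; rewrite !inE ?negb_or ?xB ?xI ?xB1 //= eqxx /= orbF.
by apply: contraNneq xB => ->.
Qed.

(** Extend [J] to a basis [B1], and [I] to a basis [B] inside [I :|: B1]. Since [B :\: I] is larger
    than [B1 :\: J], some element of it is outside [B1 :\: J], and such an element must lie in
    [J]. *)
Lemma indep_augment I J : independent M I -> independent M J -> #|I| < #|J| ->
  exists2 y, y \in J :\: I & independent M (y |: I).
Proof.
move=> iI /indepP[B1 B1M JB1] ltIJ.
have [B [BM IB BIB1]] := basis_between iI B1M.
have /subsetPn[y] : ~~ (B :\: I \subset B1 :\: J).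
  apply: contraL ltIJ => /subset_leq_card.
  rewrite !cardsDS // (card_basis BM) (card_basis B1M) -leqNgt => h.
  have := subset_leq_card JB1; rewrite (card_basis B1M) => h1.
  have := subset_leq_card IB; rewrite (card_basis BM) => h2.
  by rewrite leq_sub2lE in h.
rewrite !inE => /andP[yI yB]; rewrite negb_and negbK => yJI.
have: y \in I :|: B1 by apply: (subsetP BIB1).
rewrite inE (negPf yI) /= => yB1; move: yJI; rewrite yB1 orbF => yJ.
exists y; first by rewrite !inE yI.
by apply/indepP; exists B; rewrite // subUset sub1set yB.
Qed.

Lemma card_indep_rk I S : independent M I -> I \subset S -> #|I| <= rk M S.
Proof. by move=> iI IS; apply: (bigmax_sup I); rewrite ?iI. Qed.

Lemma card_basisI_rk B S : B \in bases M -> #|B :&: S| <= rk M S.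
Proof.
move=> BM; apply: card_indep_rk; last exact: subsetIr.
by apply: indepS (basis_indep BM); apply: subsetIl.
Qed.

Lemma rk_basis S : exists2 B, B \in bases M & #|B :&: S| = rk M S.
Proof.
have [|I /andP[/indepP[B BM IB] IS] rI] := @eq_bigmax_cond _
    [pred I : {set 'I_n} | independent M I && (I \subset S)] (fun I => #|I|).
  apply/card_gt0P; exists set0; rewrite !inE sub0set andbT.
  by have [B BM] := basesP; apply/indepP; exists B; rewrite ?sub0set.
exists B => //; apply/eqP; rewrite eqn_leq card_basisI_rk //= {1}/rk rI.
by apply: subset_leq_card; rewrite subsetI IB.
Qed.

Lemma rkS S S' : S \subset S' -> rk M S <= rk M S'.
Proof.
move=> SS'; have [B BM <-] := rk_basis S.
apply: leq_trans (card_basisI_rk S' BM); apply: subset_leq_card.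
exact: setIS.
Qed.

(** By minimality [C :\ x] and [C :\ y] are independent. Extend the first to [B1] and the second to
    [B2] inside its union with [B1]. Each basis misses the deleted element, so [B2] lies in
    [x |: (B1 :\ y)], and the cardinalities agree. *)
Lemma circuit_exchange x y : x != y ->
  (exists C, [/\ circuit M C, x \in C & y \in C]) ->
  exists B1 B2, [/\ B1 \in bases M, B2 \in bases M & x \notin B1 /\ y \in B1] /\
     B2 = x |: (B1 :\ y).
Proof.
move=> xy [C [/minsetP[depC minC] xC yC]].
have iC z : z \in C -> independent M (C :\ z).
  move=> zC; apply: contraT => dep.
  have := minC _ dep (subD1set _ _) => /setP/(_ z).
  by rewrite !inE eqxx zC.
have /indepP[B1 B1M CB1] := iC x xC.
have [B2 [B2M CB2 B2CB1]] := basis_between (iC y yC) B1M.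
have nC B : B \in bases M -> ~~ (C \subset B).
  by move=> BM; apply: contra depC => CB; apply/indepP; exists B.
have yB1 : y \in B1 by apply: (subsetP CB1); rewrite !inE eq_sym xy.
have xB2 : x \in B2 by apply: (subsetP CB2); rewrite !inE xy.
have nBz z B : C :\ z \subset B -> B \in bases M -> z \notin B.
  move=> CB BM; apply: contra (nC _ BM) => zB; apply/subsetP => u uC.
  have [-> //|uz] := eqVneq u z.
  by apply: (subsetP CB); rewrite !inE uz.
have xB1 := nBz _ _ CB1 B1M; have yB2 := nBz _ _ CB2 B2M.
exists B1, B2; split=> //; apply/eqP; rewrite eqEcard; apply/andP; split.
  apply/subsetP => z zB2; rewrite !inE.
  have zy : z != y by apply: contraNneq yB2 => <-.
  have := subsetP B2CB1 _ zB2; rewrite !inE zy /=.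
  case/orP=> [zC|->]; last by rewrite orbT.
  have [//|zx /=] := eqVneq z x.
  by apply: (subsetP CB1); rewrite !inE zx.
rewrite cardsU1 !inE (negPf xB1) andbF add1n.
by rewrite (card_basis B2M) -(card_basis B1M) (cardsD1 y B1) yB1.
Qed.

(** Augmenting [B :&: S] from a basis that attains the rank of [S] supplies [y]. Extending back
    inside [y |: B] drops exactly one element [z], which is outside [S] because [B :&: S] is
    retained. *)
Lemma basis_improve B S : B \in bases M -> #|B :&: S| < rk M S ->
  exists y z, [/\ y \in S :\: B, z \in B :\: S & y |: (B :\ z) \in bases M].
Proof.
move=> BM; have [B0 B0M <-] := rk_basis S => lt.
have iI B' : B' \in bases M -> independent M (B' :&: S).
  by move=> /basis_indep; apply/indepS/subsetIl.
have [y] := indep_augment (iI _ BM) (iI _ B0M) lt.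
rewrite !inE => /andP[+ /andP[yB0 yS]]; rewrite yS andbT => yB iy.
have [B' [B'M yB' B'B]] := basis_between iy BM.
have B'yB : B' \subset y |: B.
  apply: subset_trans B'B _.
  by rewrite -setUA setUS // subUset subsetIl /=.
have yinB' : y \in B' by apply: (subsetP yB'); rewrite !inE eqxx.
have /subsetPn[z zB zB'] : ~~ (B \subset B').
  apply/negP => BB'.
  have := subset_leq_card (_ : y |: B \subset B').
  rewrite subUset sub1set yinB' BB' cardsU1 yB add1n.
  by rewrite (card_basis BM) (card_basis B'M) ltnn => /(_ isT).
have zS : z \notin S.
  by apply: contra zB' => zS; apply: (subsetP yB'); rewrite !inE zB zS orbT.
exists y, z; split; rewrite ?inE ?yS ?yB ?zB ?zS //.
suff <- : B' = y |: (B :\ z) by [].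
apply/eqP; rewrite eqEcard; apply/andP; split.
  apply/subsetP => u uB'; have := subsetP B'yB _ uB'.
  rewrite !inE => /orP[->//|->]; rewrite andbT orbC.
  by rewrite (contraNneq _ zB') // => <-.
rewrite cardsU1 !inE (negPf yB) andbF add1n (card_basis B'M) -(card_basis BM).
by rewrite (cardsD1 z B) zB.
Qed.

(* A basis attaining the rank of [S] spans every element that does not raise
   the rank of [S], hence avoids it. *)
Lemma basis_avoid B S x : B \in bases M -> #|B :&: S| = rk M S ->
  x \notin S -> rk M (x |: S) <= rk M S -> x \notin B.
Proof.
move=> BM BS xS; apply: contraL => xB; rewrite -ltnNge -BS.
apply: leq_trans (card_basisI_rk (x |: S) BM); apply: proper_card.
apply/properP; split; first exact: setIS (subsetUr _ _).
by exists x; rewrite !inE ?xB ?eqxx // (negPf xS) andbF.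
Qed.

End MatroidTheory.

(** * Affine dimension *)

Section AffineDimension.
Variables (R : realType) (n : nat).
Implicit Types (A : set 'rV[R]_n) (c x : 'rV[R]_n) (S B : {set 'I_n}).

(** Convertible with the sum in [face]; [-/(dot _ _)] passes from one to the other. *)
Definition dot c x : R := \sum_i c 0 i * x 0 i.

Lemma dotDl c c' x : dot (c + c') x = dot c x + dot c' x.
Proof.
by rewrite -big_split; apply: eq_bigr => i _; rewrite !mxE mulrDl.
Qed.

Lemma dotZl a c x : dot (a *: c) x = a * dot c x.
Proof. by rewrite mulr_sumr; apply: eq_bigr => i _; rewrite !mxE mulrA. Qed.

Lemma dot_sumr c (I : finType) (p : I -> 'rV[R]_n) (a : I -> R) :
  dot c (\sum_i a i *: p i) = \sum_i a i * dot c (p i).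
Proof.
under [RHS]eq_bigr do rewrite mulr_sumr.
rewrite exchange_big /=; apply: eq_bigr => j _.
by rewrite summxE mulr_sumr; apply: eq_bigr => i _; rewrite !mxE mulrCA.
Qed.

Lemma dot_char S x : dot (char_vec R S) x = \sum_(i in S) x 0 i.
Proof.
rewrite [RHS]big_mkcond; apply: eq_bigr => i _; rewrite mxE.
by case: ifP; rewrite (mul1r, mul0r).
Qed.

Lemma sum_char (P : pred 'I_n) B :
  \sum_(i | P i) char_vec R B 0 i = #|[set i in B | P i]|%:R.
Proof.
under eq_bigr do rewrite mxE.
rewrite -natr_sum -sum1_card; congr (_ %:R)%R.
rewrite big_mkcond [RHS]big_mkcond; apply: eq_bigr => i _; rewrite !inE.
by case: (P i); case: (i \in B).
Qed.

Lemma dot_char_char S B :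
  dot (char_vec R S) (char_vec R B) = #|(B :&: S)%SET|%:R.
Proof.
by rewrite dot_char sum_char; congr (_ %:R)%R; apply: eq_card => i; rewrite !inE.
Qed.

(** The leading coordinate 1 turns affine independence into linear independence and affine equations
    into linear ones. *)
Definition homogenize x : 'rV[R]_(1 + n) := row_mx 1%:M x.

Lemma affinely_independentP k (p : 'I_k -> 'rV[R]_n) :
  affinely_independent p <-> row_free (\matrix_i homogenize (p i)).
Proof.
have mulE (v : 'rV[R]_k) : v *m (\matrix_i homogenize (p i)) =
    row_mx (\sum_i v 0 i)%:M (\sum_i v 0 i *: p i).
  rewrite mulmx_sum_row; under eq_bigr do rewrite rowK scale_row_mx scale_scalar_mx mulr1.
  apply/rowP => j; rewrite summxE; case: (split_ordP j) => l ->.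
    rewrite row_mxEl mxE ord1; apply: eq_bigr => i _.
    by rewrite row_mxEl mxE.
  by rewrite row_mxEr summxE; apply: eq_bigr => i _; rewrite row_mxEr.
split=> [ind|free a a0 ap0 i].
  apply: inj_row_free => v; rewrite mulE => v0.
  have [/rowP/(_ 0) + v2] := eq_row_mx (etrans v0 (esym (row_mx0 _ _ _ _))).
  rewrite !mxE eqxx => v1; apply/rowP => i; rewrite mxE.
  exact: ind (fun i => v 0 i) v1 v2 i.
have : \row_i a i = 0.
  apply/eqP; rewrite -(mulmx_free_eq0 _ free) mulE.
  under eq_bigr do rewrite mxE; rewrite a0.
  by under eq_bigr do rewrite mxE; rewrite ap0 raddf0 row_mx0.
by move/rowP/(_ i); rewrite !mxE.
Qed.

Lemma affdimS_ge A k (p : 'I_k -> 'rV[R]_n) :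
  (forall i, A (p i)) -> affinely_independent p -> (k <= affdimS A)%N.
Proof.
(* Homogenized points live in dimension [n + 1], so the bounded range of the maximum in [affdimS]
   excludes no independent family. *)
move=> Ap ind; have kn : (k < n.+2)%N.
  move/affinely_independentP: ind => /eqP <-.
  by rewrite ltnS (leq_trans (rank_leq_col _)).
rewrite /affdimS; apply: (bigop.bigmax_sup (Ordinal kn)) => //.
by apply/asboolP; exists p.
Qed.

Lemma affdimS_ex A : exists p : 'I_(affdimS A) -> 'rV[R]_n,
  (forall i, A (p i)) /\ affinely_independent p.
Proof.
have [|k /asboolP h e] := @eq_bigmax_cond 'I_n.+2 [pred k : 'I_n.+2 |
    `[< exists p : 'I_k -> 'rV[R]_n, (forall i, A (p i)) /\ affinely_independent p >]]
    (fun k => k).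
  apply/card_gt0P; exists ord0; apply/asboolP.
  by exists (fun=> 0); split=> [[]//|a _ _ []].
by rewrite /affdimS; rewrite e.
Qed.

Lemma affdimS_sub A A' : A `<=` A' -> (affdimS A <= affdimS A')%N.
Proof.
move=> AA'; have [p [Ap ip]] := affdimS_ex A.
by apply: affdimS_ge ip => i; apply: AA'.
Qed.

(** The rows of [P] are a largest affinely independent family in [A]: a point outside their span
    could be prepended, exceeding the maximum. *)
Lemma affdimS_span A : exists P : 'M[R]_(affdimS A, 1 + n),
  forall x, A x -> (homogenize x <= P)%MS.
Proof.
have [p [Ap ip]] := affdimS_ex A.
pose P := \matrix_i homogenize (p i); exists P => x Ax; apply: contraT => xP.
suff : (1 + affdimS A <= affdimS A)%N by rewrite add1n ltnn.
pose q (i : 'I_(1 + affdimS A)) := if fintype.split i is inr j then p j else x.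
apply: (@affdimS_ge _ _ q).
  by move=> i; rewrite /q; case: fintype.split.
apply/affinely_independentP.
have -> : \matrix_i homogenize (q i) =
    col_mx (homogenize x) P.
  apply/row_matrixP => i; rewrite rowK /q.
  case: split_ordP => j ->; rewrite ?rowKu ?rowKd ?rowK //.
  by rewrite ord1 row_id.
apply: inj_row_free => v; rewrite -[v]hsubmxK mul_row_col => v0.
have free := (affinely_independentP p).1 ip.
(* A nonzero coefficient on [x] would allow solving for [x] in the row space of [P]. *)
have lv0 : lsubmx v = 0.
  apply: contraNeq xP => nz; rewrite -[homogenize x]mul1mx.
  have -> : 1%:M = (lsubmx v 0 0)^-1 *: lsubmx v.
    rewrite [X in _ *: X]mx11_scalar scale_scalar_mx mulVf //.
    by apply: contraNneq nz => h; rewrite (mx11_scalar (lsubmx v)) h raddf0.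
  rewrite -scalemxAl scalemx_sub // -[lsubmx v *m _](addrK (rsubmx v *m P)) v0.
  by rewrite sub0r eqmx_opp submxMl.
have rv0 : rsubmx v = 0.
  by move: v0; rewrite lv0 mul0mx add0r => /eqP; rewrite mulmx_free_eq0 // => /eqP.
by rewrite lv0 rv0 row_mx0.
Qed.

(** The homogenized points of [A] are orthogonal to the [m] independent rows of [row_mx (- b) U], in
    a space of dimension [n + 1]. As [affdimS] is the dimension plus one, the dimension itself is at
    most [n - m]. *)
Lemma affdimS_equations m (U : 'M[R]_(m, n)) (b : 'cV[R]_m) A :
  row_free U -> (forall x, A x -> U *m x^T = b) -> (affdimS A + m <= n.+1)%N.
Proof.
move=> /eqP rU AU; have [p [Ap /affinely_independentP/eqP ip]] := affdimS_ex A.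
rewrite -{1}ip -rU.
set P := \matrix_i _.
have PU : P *m (row_mx (- b) U)^T = 0.
  apply/row_matrixP => i; rewrite row_mul rowK tr_row_mx mul_row_col mul1mx.
  by rewrite -[p i]trmxK -trmx_mul AU // linearN addNr raddf0.
apply: leq_trans (mulmx0_rank_max PU); rewrite leq_add2l mxrank_tr.
have {1}-> : U = row_mx (- b) U *m col_mx 0 1%:M.
  by rewrite mul_row_col mulmx0 add0r mulmx1.
exact: mxrankM_maxl.
Qed.

(** Restricted to the columns [w], the incidence matrix is lower triangular with ones on the
    diagonal, so the equations are independent. *)
Lemma affdimS_incidence m (S : 'I_m -> {set 'I_n}) (w : 'I_m -> 'I_n)
    (r : 'I_m -> R) A :
  (forall i, w i \in S i) -> (forall i j : 'I_m, (i < j)%N -> w j \notin S i) ->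
  (forall x i, A x -> dot (char_vec R (S i)) x = r i) ->
  (affdimS A + m <= n.+1)%N.
Proof.
move=> wS wNS AS; apply: (@affdimS_equations m (\matrix_i char_vec R (S i)) (\col_i r i)).
  apply: inj_row_free => v v0.
  pose T := colsub w (\matrix_i char_vec R (S i)).
  have T1 : T \in unitmx.
    rewrite unitmxE det_trig; last first.
      by apply/is_trig_mxP => i j ij; rewrite !mxE (negPf (wNS _ _ ij)).
    by rewrite big1 ?unitr1 // => i _; rewrite !mxE wS.
  have vT : v *m T = 0 by rewrite /T mulmx_colsub v0; apply/matrixP=> i j; rewrite !mxE.
  by rewrite -(mulmxK T1 v) vT mul0mx.
move=> x Ax; apply/colP => i; rewrite !mxE -(AS x i Ax).
by apply: eq_bigr => j _; rewrite !mxE.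
Qed.

Lemma affdimS_le_eq S r A : S != finset.set0 ->
  (forall x, A x -> dot (char_vec R S) x = r) -> (affdimS A <= n)%N.
Proof.
move=> /set0Pn[i iS] AS; rewrite -ltnS -addn1.
by apply: (@affdimS_incidence 1 (fun=> S) (fun=> i) (fun=> r)) => // [a b|x _ /AS //]; rewrite !ord1.
Qed.

Lemma affdimS_le_eq2 S1 S2 r1 r2 A : S1 != finset.set0 -> S1 \proper S2 ->
  (forall x, A x -> dot (char_vec R S1) x = r1 /\ dot (char_vec R S2) x = r2) ->
  (affdimS A < n)%N.
Proof.
move=> /set0Pn[i iS1] /properP[S12 [j jS2 jS1]] AS.
rewrite -ltnS -addn2.
apply: (@affdimS_incidence 2 (tnth [tuple S1; S2]) (tnth [tuple i; j])
  (tnth [tuple r1; r2])).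
- by case=> -[|[|]].
- by case=> -[|[|]] // ? [[|[|]]].
- by move=> x [[|[|]]] // ? /AS[].
Qed.

(** Elements of the successive differences witness independence. The dimension is thus at most
    [n - 3], one less than that of a facet of an [(n - 1)]-dimensional polytope. *)
Lemma affdimS_le_eq3 S1 S2 S3 r1 r2 r3 A :
  S1 != finset.set0 -> S1 \proper S2 -> S2 \proper S3 ->
  (forall x, A x -> [/\ dot (char_vec R S1) x = r1, dot (char_vec R S2) x = r2
     & dot (char_vec R S3) x = r3]) ->
  ((affdimS A).+1 < n)%N.
Proof.
move=> /set0Pn[i iS1] /properP[S12 [j jS2 jS1]] /properP[S23 [k kS3 kS2]] AS.
have kS1 : k \notin S1 by apply: contra kS2; apply: fintype.subsetP.
rewrite -ltnS -addn3.
apply: (@affdimS_incidence 3 (tnth [tuple S1; S2; S3]) (tnth [tuple i; j; k])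
  (tnth [tuple r1; r2; r3])).
- by case=> -[|[|[|]]].
- by case=> -[|[|[|]]] // ? [[|[|[|]]]].
- by move=> x [[|[|[|]]]] // ? /AS[].
Qed.

End AffineDimension.

(** * Faces of 0/1 polytopes *)

Section Faces.
Variables (R : realType) (n : nat).
Implicit Types (P Q F G : set 'rV[R]_n).

Lemma face_refl P : face P P.
Proof.
exists 0, 0; split=> [x _|]; first by rewrite big1 // => i _; rewrite mxE mul0r.
apply/seteqP; split=> [x Px|x []//]; split=> //=.
by rewrite big1 // => i _; rewrite mxE mul0r.
Qed.

Lemma face_sub P F : face P F -> F `<=` P.
Proof. by move=> [c [b [_ ->]]] x []. Qed.

(** Add the two supporting forms: the sum attains its bound only where both forms attain theirs. *)
Lemma face_capI P F G : face P F -> face P G -> face P (F `&` G).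
Proof.
move=> [c [b [Pb ->]]] [c' [b' [Pb' ->]]]; exists (c + c'), (b + b').
split=> [x Px|]; first by rewrite -/(dot _ _) dotDl lerD //; [exact: Pb|exact: Pb'].
apply/seteqP; split=> x /=; rewrite -!/(dot _ _) dotDl.
  by move=> [[Px ->] [_ ->]].
move=> [Px]; have := Pb _ Px; have := Pb' _ Px; rewrite -!/(dot _ _).
rewrite !le_eqVlt => /orP[/eqP->|lt'] /orP[/eqP->|lt] e //.
- by move: lt; rewrite -(ltrD2r b') e ltxx.
- by move: lt'; rewrite -(ltrD2l b) e ltxx.
- by move: (ltrD lt lt'); rewrite e ltxx.
Qed.

Lemma face_restrict P F G : face P G -> G `<=` F -> F `<=` P -> face F G.
Proof.
move=> [c [b [Pb ->]]] GF FP; exists c, b; split=> [x /FP/Pb//|].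
by apply/seteqP; split=> x [xA xc]; split=> //; [exact: GF|exact: FP].
Qed.

End Faces.

(** * Convex hulls of 0/1 vectors and their faces *)

Section ZeroOnePolytopes.
Variables (R : realType) (n : nat).
Implicit Types (V : {set {set 'I_n}}) (B S : {set 'I_n}) (c x : 'rV[R]_n).
Implicit Types (F G : set 'rV[R]_n).

(** [matroid_polytope R M] unfolds to [zopoly R (bases M)], and nonempty or empty faces of such a
    hull are hulls of the same kind. *)
Definition zopoly V : set 'rV[R]_n :=
  conv_hull [set x | exists2 B, B \in V & x = char_vec R B].

Lemma weight_support V (a : {set 'I_n} -> R) :
  (forall B, B \notin V -> a B = 0) -> \sum_B a B = 1 -> exists B, B \in V.
Proof.
move=> aV a1; apply/existsP; apply: contraT; rewrite negb_exists => /forallP nV.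
by move: a1; rewrite big1 => [/esym/eqP|B _]; rewrite ?oner_eq0 ?aV.
Qed.

(** Weights of list entries that stand for the same set are merged, which replaces arbitrary finite
    families by weights on all subsets. *)
Lemma zopolyP V x : zopoly V x <->
  exists a : {set 'I_n} -> R, [/\ forall B, 0 <= a B,
    forall B, B \notin V -> a B = 0, \sum_B a B = 1
    & x = \sum_B a B *: char_vec R B].
Proof.
split=> [[k [p [a [Vp a0 a1 ->]]]]|[a [a0 aV a1 ->]]].
  have [f fP] : {f : 'I_k -> {set 'I_n} & forall i, f i \in V /\ p i = char_vec R (f i)}.
    by apply: (@choice _ _ (fun i B => B \in V /\ p i = char_vec R B)) => i; have [B] := Vp i; exists B.
  exists (fun B => \sum_(i | f i == B) a i); split.
  - by move=> B; apply: sumr_ge0.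
  - move=> B BV; rewrite big_pred0 // => i; apply: contraNF BV => /eqP <-.
    by have [] := fP i.
  - by rewrite -a1 [RHS](partition_big f xpredT).
  - rewrite [LHS](partition_big f xpredT) //=; apply: eq_bigr => B _.
    rewrite scaler_suml; apply: eq_bigr => i /eqP <-.
    by have [_ ->] := fP i.
have [B0 B0V] := weight_support aV a1.
(* [conv_hull] requires every listed point to be a generator, even at weight 0, so sets outside [V]
   are replaced by some [B0] in [V]. *)
pose g B := if B \in V then B else B0.
exists #|{set 'I_n}|, (fun i => char_vec R (g (enum_val i))), (a \o enum_val).
split=> [i|i||].
- by exists (g (enum_val i)) => //; rewrite /g; case: ifP.
- exact: a0.
- by rewrite -a1 -(big_enum_val a).
- rewrite -(big_enum_val (fun B => a B *: char_vec R (g B))).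
  apply: eq_bigr => B _; rewrite /g; case: ifPn => // /aV ->.
  by rewrite !scale0r.
Qed.

Lemma char_vec_zopoly V B : B \in V -> zopoly V (char_vec R B).
Proof.
move=> BV; exists 1%N, (fun=> char_vec R B), (fun=> 1).
by split=> // [_||]; rewrite ?big_ord1 ?scale1r //; exists B.
Qed.

Lemma zopoly_convex V x y (t : R) : 0 <= t <= 1 ->
  zopoly V x -> zopoly V y -> zopoly V (t *: x + (1 - t) *: y).
Proof.
move=> /andP[t0 t1] /zopolyP[a [a0 aV a1 ->]] /zopolyP[b [b0 bV b1 ->]].
apply/zopolyP; exists (fun B => t * a B + (1 - t) * b B); split.
- by move=> B; rewrite addr_ge0 // mulr_ge0 // subr_ge0.
- by move=> B BV; rewrite aV ?bV ?mulr0 ?addr0.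
- by rewrite big_split /= -!mulr_sumr a1 b1 !mulr1 addrC subrK.
- rewrite !scaler_sumr -big_split; apply: eq_bigr => B _ /=.
  by rewrite !scalerA -scalerDl.
Qed.

Lemma zopoly_le V c b x : (forall B, B \in V -> dot c (char_vec R B) <= b) ->
  zopoly V x -> dot c x <= b.
Proof.
move=> Vb /zopolyP[a [a0 aV a1 ->]]; rewrite dot_sumr.
rewrite -[b]mul1r -a1 mulr_suml; apply: ler_sum => B _.
by have [/Vb|/aV ->] := boolP (B \in V); rewrite ?mul0r //; apply: ler_wpM2l.
Qed.

Lemma zopoly_eq V c b x : (forall B, B \in V -> dot c (char_vec R B) = b) ->
  zopoly V x -> dot c x = b.
Proof.
move=> Vb /zopolyP[a [a0 aV a1 ->]]; rewrite dot_sumr.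
rewrite -[b in RHS]mul1r -a1 mulr_suml; apply: eq_bigr => B _.
by have [/Vb->//|/aV ->] := boolP (B \in V); rewrite !mul0r.
Qed.

(** On the hyperplane the weighted slacks sum to zero. Being nonnegative, they vanish one by one, so
    only sets attaining [b] carry weight. *)
Lemma zopoly_face V c b : (forall B, B \in V -> dot c (char_vec R B) <= b) ->
  zopoly V `&` [set x | dot c x = b] =
  zopoly [set B in V | dot c (char_vec R B) == b].
Proof.
move=> Vb; apply/seteqP; split=> x; last first.
  move=> /zopolyP[a [a0 aV a1 xE]]; split.
    apply/zopolyP; exists a; split=> // B BV; apply: aV.
    by rewrite inE negb_and BV.
  have : zopoly [set B in V | dot c (char_vec R B) == b]%SET x.
    by apply/zopolyP; exists a.
  by apply: zopoly_eq => B; rewrite inE => /andP[_ /eqP].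
move=> [/zopolyP[a [a0 aV a1 ->]] /=]; rewrite dot_sumr => e.
have gap_ge0 B : 0 <= a B * (b - dot c (char_vec R B)).
  have [/Vb|/aV ->] := boolP (B \in V); last by rewrite mul0r.
  by rewrite -subr_ge0 => /(mulr_ge0 (a0 B)).
have gap0 : \sum_B a B * (b - dot c (char_vec R B)) = 0.
  by under eq_bigr do rewrite mulrBr; rewrite sumrB e -mulr_suml a1 mul1r subrr.
apply/zopolyP; exists a; split=> // B; rewrite inE negb_and.
case/orP=> [/aV//|ne]; have /psumr_eq0P/(_ gap0 B isT)/eqP : forall B, true ->
    0 <= a B * (b - dot c (char_vec R B)) by move=> *.
by rewrite mulf_eq0 subr_eq0 [b == _]eq_sym (negPf ne) orbF => /eqP.
Qed.

Lemma face_zopoly V F : face (zopoly V) F ->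
  exists2 V' : {set {set 'I_n}}, V' \subset V & F = zopoly V'.
Proof.
move=> [c [b [Vb ->]]]; exists [set B in V | dot c (char_vec R B) == b]%SET.
  by apply/fintype.subsetP => B; rewrite inE => /andP[].
by rewrite -zopoly_face // => B BV; apply: Vb; apply: char_vec_zopoly.
Qed.

(** The form [N *: c + c'] cuts out [G] once [N] is so large that the generators off [F] stay
    strictly below the bound, whatever [c'] does there. *)
Lemma face_trans V F G : face (zopoly V) F -> face F G -> face (zopoly V) G.
Proof.
move=> [c [b [Vb ->]]] [c' [b' [Fb' ->]]].
pose h B := dot c (char_vec R B); pose h' B := dot c' (char_vec R B).
(* [N] exceeds each ratio of the excess of [c'] to the slack of [c] at a generator off [F]; the
   summand 1 makes this strict. *)
pose N := 1 + \sum_(B in V | h B != b) `|h' B - b'| / (b - h B).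
have hb B : B \in V -> h B <= b by move=> BV; apply/Vb/char_vec_zopoly.
have gap B : B \in V -> h B != b -> 0 < b - h B.
  by move=> BV ne; rewrite subr_gt0 lt_neqAle ne hb.
have hb' B : B \in V -> h B = b -> h' B <= b'.
  by move=> BV e; apply: Fb'; split=> //; apply: char_vec_zopoly.
have Nh B : B \in V -> h B != b -> N * h B + h' B < N * b + b'.
  move=> BV ne; rewrite -subr_gt0.
  have -> : N * b + b' - (N * h B + h' B) = N * (b - h B) - (h' B - b').
    by rewrite mulrBr !opprD !addrA opprK; rewrite -!addrA; congr (_ + _);
       rewrite addrC -!addrA; congr (_ + _); rewrite addrC.
  rewrite subr_gt0 (le_lt_trans (ler_norm _)) // -ltr_pdivrMr ?gap //.
  rewrite /N (bigD1 B) ?BV //= addrCA ltrDl ltr_wpDr //.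
  by apply: sumr_ge0 => B' /andP[/andP[B'V ne'] _]; rewrite divr_ge0 // ltW ?gap.
have le B : B \in V -> dot (N *: c + c') (char_vec R B) <= N * b + b'.
  move=> BV; rewrite dotDl dotZl.
  have [e|/Nh/ltW] := eqVneq (h B) b; last exact.
  by rewrite -/(h B) e lerD2l; apply: hb'.
exists (N *: c + c'), (N * b + b'); split=> [x|]; first exact: zopoly_le.
rewrite [RHS]zopoly_face // [X in X `&` _]zopoly_face // zopoly_face; last first.
  by move=> B; rewrite inE => /andP[BV /eqP]; apply: hb'.
congr zopoly; apply/setP => B; rewrite !inE dotDl dotZl -/(h B) -/(h' B).
case: (boolP (B \in V)) => //= BV.
case: eqVneq => [e|ne] /=; last by rewrite (lt_eqF (Nh _ BV ne)).
by rewrite e (inj_eq (addrI _)).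
Qed.

Lemma vertex_zopoly V v :
  vertex (zopoly V) v -> exists2 B, B \in V & v = char_vec R B.
Proof.
move=> /face_zopoly[V' /fintype.subsetP V'V vE].
have /zopolyP[a [_ aV' a1 _]] : zopoly V' v by rewrite -vE.
have [B BV'] := weight_support aV' a1.
exists B; first exact: V'V.
by have : [set v] (char_vec R B) by rewrite vE; apply: char_vec_zopoly.
Qed.

Lemma finite_zopoly_faces V : finite_set (face (zopoly V)).
Proof.
apply: (@sub_finite_set _ _ (zopoly @` [set: {set {set 'I_n}}])).
  by move=> F /face_zopoly[V' _ ->]; exists V'.
exact/finite_image/finite_finset.
Qed.

Lemma polytope_zopoly V : polytope (zopoly V).
Proof.
exists [set x | exists2 B, B \in V & x = char_vec R B]; split=> //.
apply: (@sub_finite_set _ _ (char_vec R @` [set: {set 'I_n}])).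
  by move=> x [B _ ->]; exists B.
exact/finite_image/finite_finset.
Qed.

(** The form with coefficient 1 on [B] and -1 off [B] is maximal on the cube at [char_vec R B]
    only. *)
Lemma char_vec_vertex d B : hypersimplex R n d (char_vec R B) ->
  vertex (hypersimplex R n d) (char_vec R B).
Proof.
move=> HB.
pose c : 'rV[R]_n := \row_i (if i \in B then 1 else -1).
have le x : hypersimplex R n d x ->
    dot c x <= \sum_i (i \in B)%:R ?= iff [forall i, x 0 i == (i \in B)%:R].
  move=> [x01 _]; apply: leif_sum => i _; rewrite mxE.
  have /andP[x0 x1] := x01 i.
  case: (i \in B); rewrite ?mul1r ?mulN1r; apply/leifP.
    by case: ifPn => // ne; rewrite lt_neqAle x1 andbT.
  case: ifPn => [/eqP->|ne]; first by rewrite oppr0.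
  by rewrite oppr_lt0 lt_neqAle x0 andbT eq_sym.
exists c, (\sum_i (i \in B)%:R); split=> [x /le[]//|].
apply/seteqP; split=> [x ->|x [Hx /eqP]].
  split=> //; apply/eqP; rewrite /= -/(dot _ _) (le _ HB).2.
  by apply/forallP => i; rewrite mxE.
rewrite -/(dot _ _) (le _ Hx).2 => /forallP xB.
by apply/rowP => i; rewrite mxE; apply/eqP.
Qed.

End ZeroOnePolytopes.
Arguments zopoly R {n} V.

(** * Splits along a hyperplane *)

Section HalfSpaceSplit.
Variables (R : realType) (n : nat).
Variables (V1 V2 : {set {set 'I_n}}) (P : set 'rV[R]_n) (c : 'rV[R]_n) (b : R).
Let C : set 'rV[R]_n := P `&` [set x | dot c x <= b].
Let D : set 'rV[R]_n := P `&` [set x | b <= dot c x].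
Hypothesis CE : C = zopoly R V1.
Hypothesis DE : D = zopoly R V2.
Hypothesis vertexP : forall B, P (char_vec R B) -> vertex P (char_vec R B).
Hypothesis CD : ~ C `<=` D.
Hypothesis DC : ~ D `<=` C.
Implicit Types (F G Q : set 'rV[R]_n).

Let faceCD : face C (C `&` D).
Proof.
exists c, b; split=> [x []//|].
apply/seteqP; split=> x.
  by move=> [[Px xb] [_ bx]]; split=> //; apply/eqP; rewrite eq_le; apply/andP.
by move=> [Cx /= e]; split=> //; split; [case: Cx|rewrite /= /dot e].
Qed.

Let faceDC : face D (C `&` D).
Proof.
have dotN x : dot (- c) x = - dot c x by rewrite -scaleN1r dotZl mulN1r.
exists (- c), (- b); split=> [x [_ bx]|]; first by rewrite -/(dot _ _) dotN lerN2.
apply/seteqP; split=> x.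
  move=> [[Px xb] Dx]; split=> //=; rewrite -/(dot _ _) dotN; congr (- _).
  by apply/eqP; rewrite eq_le; apply/andP; split=> //; case: Dx.
move=> [Dx /=]; rewrite -/(dot _ _) dotN => /oppr_inj e.
by split=> //; split; [case: Dx|rewrite /= e].
Qed.

Let Sigma : set (set 'rV[R]_n) := face C `|` face D.

Let face_trans_CD Q F : Sigma Q -> face Q F -> Sigma F.
Proof.
by case=> QC FQ; [left; rewrite CE|right; rewrite DE];
   apply: face_trans FQ; rewrite -?CE -?DE.
Qed.

(** The intersection lies in the wall [C :&: D], on which [F] and [G] both cut out faces; faces of
    the wall are faces of either half by transitivity. *)
Let face_meet F G : face C F -> face D G -> face C (F `&` G) /\ face D (F `&` G).
Proof.
move=> FC GD.
have FGE : F `&` G = (F `&` (C `&` D)) `&` (G `&` (C `&` D)).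
  apply/seteqP; split=> x; last by move=> [[? _] [? _]].
  by move=> [Fx Gx]; have := face_sub FC Fx; have := face_sub GD Gx.
have h : face (C `&` D) (F `&` G).
  rewrite FGE; apply: face_capI.
    by apply: face_restrict (face_capI FC faceCD) _ _ => x [].
  by apply: face_restrict (face_capI GD faceDC) _ _ => x [].
by split; [rewrite CE; apply: face_trans h; rewrite -CE
          |rewrite DE; apply: face_trans h; rewrite -DE].
Qed.

(** The cells are all faces of the two halves. Every cell lies in one half and neither half lies in
    the other, so the halves are the maximal cells. *)
Lemma halfspace_split : split_with_cells P Sigma C D.
Proof.
split; last first.
- have maxC : maximal_cell Sigma C.
    split=> [|Q [/face_sub QC CQ|/face_sub QD CQ]].
    - by left; apply: face_refl.
    - exact/seteqP.
    - by case: CD => x /CQ/QD.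
  have maxD : maximal_cell Sigma D.
    split=> [|Q [/face_sub QC DQ|/face_sub QD DQ]].
    - by right; apply: face_refl.
    - by case: DC => x /DQ/QC.
    - exact/seteqP.
  move=> Q; split=> [[[] /face_sub sub maxQ]|[]-> //].
    by left; apply/esym/maxQ => //; case: maxC.
  by right; apply/esym/maxQ => //; case: maxD.
- by move=> e; apply: CD; rewrite -e.
split.
- split.
  + by rewrite finite_setU; split; [rewrite CE|rewrite DE]; apply: finite_zopoly_faces.
  + move=> Q []; rewrite ?CE ?DE => /face_zopoly[V _ ->]; exact: polytope_zopoly.
  + exact: face_trans_CD.
  + have meet F G : face C F \/ face D F -> face C G \/ face D G ->
        face F (F `&` G) /\ face G (F `&` G).
      have restr Q F' : face Q F' -> face Q (F `&` G) -> F `&` G `<=` F' -> face F' (F `&` G).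
        by move=> QF' QFG sub; apply: face_restrict QFG sub (face_sub QF').
      move=> [FC|FD] [GC|GD].
      * have h := face_capI FC GC.
        by split; [apply: restr FC h _|apply: restr GC h _] => x [].
      * have [h1 h2] := face_meet FC GD.
        by split; [apply: restr FC h1 _|apply: restr GD h2 _] => x [].
      * have [h1 h2] := face_meet GC FD; rewrite setIC in h1 h2.
        by split; [apply: restr FD h2 _|apply: restr GC h1 _] => x [].
      * have h := face_capI FD GD.
        by split; [apply: restr FD h _|apply: restr GD h _] => x [].
    exact: meet.
- apply/seteqP; split=> x.
    by move=> [Q [/face_sub QC /QC []|/face_sub QD /QD []]].
  move=> Px; have [xb|/ltW bx] := leP (dot c x) b.
    by exists C; [left; apply: face_refl|split].
  by exists D; [right; apply: face_refl|split].
- move=> Q v QS vQ.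
  (* By transitivity a vertex of a cell is a vertex of a half, hence a 0/1 point of [P], and these
     are vertices of [P] by hypothesis. *)
  have [vC|vD] : Sigma [set v] := face_trans_CD QS vQ.
    have [Pv _] : C v by apply: (face_sub vC).
    by move: vC Pv; rewrite CE => /vertex_zopoly[B _ ->]; apply: vertexP.
  have [Pv _] : D v by apply: (face_sub vD).
  by move: vD Pv; rewrite DE => /vertex_zopoly[B _ ->]; apply: vertexP.
Qed.

End HalfSpaceSplit.

(** * Integrality of the half hypersimplices *)

Section Integrality.
Variables (R : realType) (n : nat).
Implicit Types (x y : 'rV[R]_n) (G : {set 'I_n}) (i j k : 'I_n).

Lemma dotC c x : dot c x = dot x c :> R.
Proof. by apply: eq_bigr => i _; rewrite mulrC. Qed.

Lemma dot_char1 i x : dot (char_vec R [set i]%SET) x = x 0 i.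
Proof. by rewrite dot_char big_set1. Qed.

Lemma dot_charT x : dot (char_vec R [set: 'I_n]%SET) x = \sum_i x 0 i.
Proof. by rewrite dot_char; apply: eq_bigl => i; rewrite inE. Qed.

Lemma dot_charC G x :
  dot (char_vec R G) x + dot (char_vec R (~: G)%SET) x = \sum_i x 0 i.
Proof.
rewrite -dotDl -dot_charT; congr dot; apply/rowP => i; rewrite !mxE !inE.
by case: (i \in G); rewrite ?addr0 ?add0r.
Qed.

Definition fractional x : {set 'I_n} := [set i | (x 0 i != 0) && (x 0 i != 1)]%SET.

Lemma sum_integral x G : {in G, forall i, i \notin fractional x} ->
  exists m : nat, \sum_(i in G) x 0 i = m%:R.
Proof.
move=> G0; exists #|[set i in G | x 0 i == 1]%SET|.
rewrite -sum1_card natr_sum big_mkcond [RHS]big_mkcond; apply: eq_bigr => i _.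
rewrite inE; case: (boolP (i \in G)) => //= /G0.
rewrite inE negb_and !negbK; by case/orP=> /eqP ->; rewrite ?eqxx // eq_sym oner_eq0.
Qed.

(** Moves mass from coordinate [j] to coordinate [i] until [x 0 i] reaches 1 or [x 0 j] reaches 0,
    whichever happens first. *)
Definition shift x i j : 'rV[R]_n :=
  x + Num.min (1 - x 0 i) (x 0 j) *: (char_vec R [set i]%SET - char_vec R [set j]%SET).

Lemma dot_shift G x i j : dot (char_vec R G) (shift x i j) =
  dot (char_vec R G) x + Num.min (1 - x 0 i) (x 0 j) * ((i \in G)%:R - (j \in G)%:R).
Proof.
rewrite dotC dotDl dotZl dotDl -scaleN1r dotZl !dot_char1 dotC !mxE.
by rewrite mulN1r.
Qed.

Section Shift.
Variables (x : 'rV[R]_n) (i j : 'I_n).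
Hypothesis x01 : forall k, 0 <= x 0 k <= 1.
Hypothesis ij : i != j.
Hypotheses (fi : i \in fractional x) (fj : j \in fractional x).
Let t := Num.min (1 - x 0 i) (x 0 j).

Lemma fractional_itv k : k \in fractional x -> 0 < x 0 k < 1.
Proof.
rewrite inE => /andP[x0 x1]; have /andP[le0 le1] := x01 k.
by rewrite !lt_neqAle le0 le1 x1 eq_sym x0.
Qed.

Lemma shift_gt0 : 0 < t.
Proof.
have /andP[_ i1] := fractional_itv fi; have /andP[j0 _] := fractional_itv fj.
by rewrite lt_min subr_gt0 i1.
Qed.

Lemma shiftE k : shift x i j 0 k =
  if k == i then x 0 i + t else if k == j then x 0 j - t else x 0 k.
Proof.
rewrite -[LHS]dot_char1 dot_shift dot_char1 !inE -/t ![_ == k]eq_sym.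
case: eqVneq => [->|_]; last case: eqVneq => [->|_].
- by rewrite (negPf ij) subr0 mulr1.
- by rewrite sub0r mulrN1.
- by rewrite subrr mulr0 addr0.
Qed.

Lemma shift01 k : 0 <= shift x i j 0 k <= 1.
Proof.
have t0 := ltW shift_gt0; have [ti tj] : t <= 1 - x 0 i /\ t <= x 0 j.
  by rewrite /t !ge_min !lexx orbT.
rewrite shiftE; have /andP[i0 i1] := x01 i; have /andP[j0 j1] := x01 j.
case: eqVneq => _; last case: eqVneq => _; last exact: x01.
- by rewrite addr_ge0 // addrC -lerBrDr.
- by rewrite subr_ge0 tj lerBlDr (le_trans j1) // lerDl.
Qed.

Lemma fractional_shift : fractional (shift x i j) \proper fractional x.
Proof.
apply/properP; split.
  apply/fintype.subsetP => k; have [->//|ki] := eqVneq k i.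
  have [->//|kj] := eqVneq k j.
  by rewrite !inE shiftE (negPf ki) (negPf kj).
have : t = 1 - x 0 i \/ t = x 0 j by rewrite /t minElt; case: ifP; [left|right].
case=> tE; [exists i|exists j] => //; rewrite inE shiftE.
  by rewrite eqxx tE addrC subrK eqxx andbF.
by rewrite [j == i]eq_sym (negPf ij) eqxx tE subrr eqxx.
Qed.

(* If [i] is the only fractional coordinate in [G], then the sum over [G] of
   the other coordinates is an integer below [r], so [x 0 i] may grow to 1. *)
Lemma shift_le G (r : nat) : dot (char_vec R G) x <= r%:R ->
  (i \in G -> j \notin G -> G :&: fractional x \subset [set i])%SET ->
  dot (char_vec R G) (shift x i j) <= r%:R.
Proof.
move=> xr ijG; have t0 := ltW shift_gt0.
have [/andP[iG jG]|nij] := boolP ((i \in G) && (j \notin G)); last first.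
  rewrite dot_shift (le_trans _ xr) // gerDl mulr_ge0_le0 //.
  by move: nij; case: (i \in G); case: (j \in G); rewrite // ?subrr // sub0r lerN10.
have [|m mE] := @sum_integral x (G :\ i)%SET.
  move=> k; rewrite finset.in_setD1 => /andP[ki kG]; apply/negP => kf.
  have := fintype.subsetP (ijG iG jG) k; rewrite finset.in_setI finset.in_set1 kG kf (negPf ki).
  by move=> /(_ isT).
have yE : \sum_(k in (G :\ i)%SET) shift x i j 0 k = m%:R.
  rewrite -mE; apply: eq_bigr => k; rewrite !inE => /andP[ki kG].
  by rewrite shiftE (negPf ki); case: eqVneq => // kj; rewrite -kj kG in jG.
have mr : (m.+1 <= r)%N.
  rewrite -(ltr_nat R) (lt_le_trans _ xr) // dot_char (big_setD1 i) //= mE.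
  by rewrite ltrDr; case/andP: (fractional_itv fi).
rewrite dot_char (big_setD1 i) //= yE addrC.
rewrite (le_trans (_ : _ <= m.+1%:R)) ?ler_nat //.
by rewrite -natr1 lerD2l; case/andP: (shift01 i).
Qed.

End Shift.

(** The two shifts move along the same line in opposite directions by [t] and [s], so [x] is their
    convex combination with weights [s / (t + s)] and [t / (t + s)]. *)
Lemma zopoly_between V x i j : (forall k, 0 <= x 0 k <= 1) -> i != j ->
  i \in fractional x -> j \in fractional x ->
  zopoly R V (shift x i j) -> zopoly R V (shift x j i) -> zopoly R V x.
Proof.
move=> x01 ij fi fj.
have t0 := shift_gt0 x01 fi fj; have s0 := shift_gt0 x01 fj fi.
rewrite /shift; set t := Num.min _ _ in t0 *; set s := Num.min _ _ in s0 *.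
set u := char_vec R _; set v := char_vec R _ => yV zV.
have ts0 : 0 < t + s by rewrite addr_gt0.
have := zopoly_convex (t := s / (t + s)) _ yV zV.
have -> : s / (t + s) *: (x + t *: (u - v)) + (1 - s / (t + s)) *: (x + s *: (v - u)) = x.
  apply/rowP => k; rewrite !mxE; field; exact: lt0r_neq0.
apply; rewrite divr_ge0 ?(ltW s0) ?(ltW ts0) //=.
by rewrite ler_pdivrMr // mul1r lerDr ltW.
Qed.

(** Two fractional coordinates on the same side of [G] are preferred, as shifting them preserves the
    sum over [G]. If there are none, each side has at most one fractional coordinate, which gives
    the last two clauses. *)
Lemma exists_shift_pair (d : nat) G x : (forall k, 0 <= x 0 k <= 1) ->
  \sum_k x 0 k = d%:R -> fractional x != finset.set0 ->
  exists i j, [/\ i != j, i \in fractional x, j \in fractional x,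
   i \in G -> j \notin G -> G :&: fractional x \subset [set i] &
   j \in G -> i \notin G -> G :&: fractional x \subset [set j]]%SET.
Proof.
move=> x01 xd /set0Pn[i fi].
have [j fj ij] : exists2 j, j \in fractional x & i != j.
  apply/exists_inP; apply: contraT => /exists_inPn onlyi.
  (* Were [i] the only fractional coordinate, the integer [d] would lie strictly between [m] and
     [m + 1]. *)
  have [|m mE] := @sum_integral x [set~ i]%SET.
    move=> k; rewrite finset.in_setC1 => ki; apply/negP => kf.
    by have := onlyi k kf; rewrite eq_sym ki.
  have /andP[i0 i1] := fractional_itv x01 fi.
  move: xd; rewrite (bigD1 i) //=.
  under eq_bigl do rewrite -finset.in_setC1; rewrite mE => xd.
  have : (m < d)%N by rewrite -(ltr_nat R) -xd ltrDr.
  have : (d < m.+1)%N by rewrite -(ltr_nat R) -xd -natr1 addrC ltrD2l.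
  by rewrite ltnS leqNgt => /negPf->.
have [/existsP[a /existsP[b /and4P[fa fb ab /eqP e]]]|same] := boolP
    [exists a, exists b, [&& a \in fractional x, b \in fractional x, a != b
      & (a \in G) == (b \in G)]].
  by exists a, b; split; rewrite // e => ->.
have only k l : k \in G -> l \in G -> k \in fractional x -> l \in fractional x ->
    k = l.
  move=> kG lG fk fl; apply/eqP; apply: contraNT same => kl.
  by apply/existsP; exists k; apply/existsP; exists l; rewrite fk fl kl kG lG.
exists i, j; split=> // lG _; apply/fintype.subsetP => k; rewrite finset.in_setI finset.in_set1;
  by case/andP=> kG fk; apply/eqP/only.
Qed.

(** Induction on the number of fractional coordinates: [x] lies between two shifts that stay in the
    half and have fewer of them. Without fractional coordinates [x] is a 0/1 vector. *)
Lemma hypersimplex_le_zopoly (d r : nat) G :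
  hypersimplex R n d `&` [set x | dot (char_vec R G) x <= r%:R] =
  zopoly R [set B : {set 'I_n} | (#|B| == d) && (#|B :&: G| <= r)%N]%SET.
Proof.
set V := finset _; apply/seteqP; split=> x; last first.
  move=> Vx; split; last first.
    by apply: zopoly_le Vx => B; rewrite inE dot_char_char ler_nat => /andP[].
  split; last first.
    rewrite -dot_charT; apply: zopoly_eq Vx => B.
    by rewrite inE dot_char_char finset.setIT => /andP[/eqP->].
  move/zopolyP: Vx => [a [a0 aV a1 ->]] i.
  rewrite -dot_char1 dot_sumr; apply/andP; split.
    by apply: sumr_ge0 => B _; rewrite mulr_ge0 // dot_char1 mxE ler0n.
  rewrite -a1; apply: ler_sum => B _; rewrite dot_char1 mxE.
  by rewrite ler_piMr // lern1 leq_b1.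
move=> [[x01 xd]]; have [m] := ubnP #|fractional x|.
elim: m x x01 xd => // m IH x x01 xd /[!ltnS] lem xr.
have [/eqP f0|fN0] := boolP (fractional x == finset.set0).
  pose B : {set 'I_n} := [set i | x 0 i == 1]%SET.
  have xE : x = char_vec R B.
    apply/rowP => i; rewrite mxE inE; have : i \notin fractional x by rewrite f0 inE.
    rewrite inE negb_and !negbK => /orP[]/eqP->; rewrite ?eqxx //.
    by rewrite eq_sym oner_eq0.
  rewrite xE; apply: char_vec_zopoly; rewrite inE; apply/andP; split.
    by rewrite -(eqr_nat R) -xd xE sum_char; apply/eqP; congr (_ %:R); apply: eq_card => i; rewrite inE andbT.
  by rewrite -(ler_nat R) -dot_char_char -xE.
have [i [j [ij fi fj Gi Gj]]] := exists_shift_pair G x01 xd fN0.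
have sumS k l : \sum_u shift x k l 0 u = d%:R.
  by rewrite -dot_charT dot_shift !inE subrr mulr0 addr0 dot_charT.
apply: (zopoly_between x01 ij fi fj); apply: IH => //.
- exact: shift01.
- exact: leq_trans (proper_card (fractional_shift _ _ _)) lem.
- exact: shift_le.
- by apply: shift01; rewrite // eq_sym.
- by apply: leq_trans (proper_card (fractional_shift _ _ _)) lem; rewrite // eq_sym.
- by apply: shift_le; rewrite // eq_sym.
Qed.

End Integrality.

(** * Facets of the matroid polytope *)

Section HypersimplexSplit.
Variables (R : realType) (n d : nat).
Implicit Types (S F B : {set 'I_n}) (x c : 'rV[R]_n).

Lemma hypersimplex_char_vec B :
  #|B| = d -> hypersimplex R n d (char_vec R B).
Proof.
move=> Bd; split=> [i|]; first by rewrite mxE ler0n lern1 leq_b1.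
by rewrite -dot_charT dot_char_char finset.setIT Bd.
Qed.

Lemma sub_aff_hull (A : set 'rV[R]_n) : A `<=` aff_hull A.
Proof.
move=> x Ax; exists 1%N, (fun=> x), (fun=> 1).
by split=> //; rewrite big_ord1 ?scale1r.
Qed.

Lemma aff_hull_dot (A : set 'rV[R]_n) c b :
  (forall x, A x -> dot c x = b) -> forall x, aff_hull A x -> dot c x = b.
Proof.
move=> Ab _ [k [p [a [Ap a1 ->]]]]; rewrite dot_sumr.
by under eq_bigr do rewrite Ab //; rewrite -mulr_suml a1 mul1r.
Qed.

Lemma hypersimplex_split F (r : nat) : (r <= d)%N ->
  let L := hypersimplex R n d `&` [set x | dot (char_vec R F) x = r%:R] in
  (exists2 x, hypersimplex R n d x & dot (char_vec R F) x < r%:R) ->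
  (exists2 x, hypersimplex R n d x & r%:R < dot (char_vec R F) x) ->
  (affdimS L).+1 = affdimS (hypersimplex R n d) ->
  split_hyperplane (hypersimplex R n d) (aff_hull L).
Proof.
move=> rd L [x Hx xr] [y Hy ry] dimL.
pose C := hypersimplex R n d `&` [set x | dot (char_vec R F) x <= r%:R].
pose D := hypersimplex R n d `&` [set x | r%:R <= dot (char_vec R F) x].
have CDL : C `&` D = L.
  apply/seteqP; split=> z; last by move=> [Hz /= zr]; do ! split => //=; rewrite zr.
  by move=> [[Hz zr] [_ rz]]; split=> //; apply/eqP; rewrite eq_le; apply/andP.
(* Passing to the complement turns the lower bound [r] into the upper bound [d - r], so integrality
   covers this half too; [r <= d] keeps the natural subtraction exact. *)
have DE : D = hypersimplex R n d `&`
    [set x | dot (char_vec R (~: F)%SET) x <= (d - r)%N%:R].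
  apply/seteqP; split=> z [Hz zr]; split=> //; move: zr => /=.
    by rewrite natrB // -Hz.2 -(dot_charC F) addrAC lerDr subr_ge0.
  by rewrite natrB // -Hz.2 -(dot_charC F) addrAC lerDr subr_ge0.
exists (face C `|` face D), C, D; split; rewrite ?CDL //.
rewrite hypersimplex_le_zopoly in DE.
apply: (halfspace_split (hypersimplex_le_zopoly R d r F) DE).
- by move=> B; apply: char_vec_vertex.
- move=> CD; have [] := CD x _; first by split=> //; apply: ltW.
  by move=> _ /=; rewrite leNgt xr.
- move=> DC; have [] := DC y _; first by split=> //; apply: ltW.
  by move=> _ /=; rewrite leNgt ry.
Qed.

End HypersimplexSplit.

(** * Dimension and facets of the matroid polytope *)

Section MatroidPolytopeFacets.
Variables (R : realType) (n : nat) (M : matroid n).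
Local Notation d := (matroid_rank M).
Local Notation P := (matroid_polytope R M).
Local Notation Delta := (hypersimplex R n d).
Implicit Types (S F B : {set 'I_n}) (x c : 'rV[R]_n) (Phi : set 'rV[R]_n).

Lemma dot_exchange c B (y z : 'I_n) : y \notin B -> z \in B ->
  dot c (char_vec R (y |: (B :\ z))%SET) =
  dot c (char_vec R B) - c 0 z + c 0 y.
Proof.
move=> yB zB; rewrite ![dot c _]dotC !dot_char big_setU1 /=; last first.
  by rewrite !inE (negPf yB) andbF.
by rewrite [in RHS](big_setD1 z) //= [c 0 z + _]addrC addrK addrC.
Qed.

Lemma matroid_polytope_le S :
  P `<=` Delta `&` [set x | dot (char_vec R S) x <= (rk M S)%:R].
Proof.
rewrite hypersimplex_le_zopoly => x /zopolyP[a [a0 aM a1 ->]].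
apply/zopolyP; exists a; split=> // B; rewrite inE => nB; apply: aM.
by apply: contra nB => BM; rewrite (card_basis BM) eqxx card_basisI_rk.
Qed.

Lemma matroid_polytope_hypersimplex : P `<=` Delta.
Proof. by move=> x /(matroid_polytope_le finset.set0)[]. Qed.

Lemma matroid_polytope_face S :
  P `&` [set x | dot (char_vec R S) x = (rk M S)%:R] =
  zopoly R [set B in bases M | #|B :&: S| == rk M S]%SET.
Proof.
rewrite [LHS](@zopoly_face _ _ (bases M)) => [|B BM].
  by congr zopoly; apply/setP => B; rewrite !inE dot_char_char eqr_nat.
by rewrite dot_char_char ler_nat card_basisI_rk.
Qed.

(** Otherwise an exchange brings some [y] in [S] into [B] for some [z] outside [S], which raises the
    weight. *)
Lemma max_weight_basis c B S : B \in bases M ->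
  (forall B', B' \in bases M -> dot c (char_vec R B') <= dot c (char_vec R B)) ->
  (forall y z, y \in S -> z \notin S -> c 0 z < c 0 y) ->
  #|B :&: S| = rk M S.
Proof.
move=> BM maxB Sc; apply/eqP; rewrite eqn_leq card_basisI_rk //= leqNgt.
apply/negP => /(basis_improve BM)[y [z []]].
rewrite !inE => /andP[yB yS] /andP[zS zB] /maxB.
rewrite dot_exchange // -addrA gerDl addrC subr_le0.
by rewrite leNgt (Sc y z).
Qed.

Hypothesis n_ge2 : (2 <= n)%N.
Hypothesis M_connected : matroid_connected M.

Lemma affdimS_hypersimplex_le : (affdimS Delta <= n)%N.
Proof.
apply: (@affdimS_le_eq _ _ [set: 'I_n]%SET d%:R).
  by apply/set0Pn; exists (Ordinal (ltnW n_ge2)); rewrite inE.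
by move=> x [_ <-]; rewrite dot_charT.
Qed.

(** The kernel of [Q^T] consists of affine equations valid on the polytope. Exchanges along circuits
    force equal coefficients, so each is a multiple of the equation that the coordinates sum to [d],
    and the kernel has rank at most 1. *)
Lemma affdimS_connected : (n <= affdimS P)%N.
Proof.
have [Q PQ] := affdimS_span P.
suff : (\rank (kermx Q^T) <= 1)%N.
  rewrite mxrank_ker mxrank_tr leq_subLR (addnC (\rank Q)) leq_add2l => /leq_trans; apply.
  exact: rank_leq_row.
(* The equation that the coordinates sum to [d], in homogenized form. *)
pose u : 'rV[R]_(1 + n) := row_mx (- d%:R)%:M (const_mx 1).
suff /mxrankS/leq_trans : (kermx Q^T <= u)%MS by apply; apply: rank_leq_row.
apply/row_subP => i; set w := row i _.
have wQ : w *m Q^T = 0 by apply/sub_kermxP/row_sub.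
move: w wQ => w wQ.
have wP x : P x -> w 0 (lshift n 0) + dot (rsubmx w) x = 0.
  move=> /PQ/submxP[D xE].
  have : w *m (homogenize x)^T = 0.
    by rewrite xE trmx_mul mulmxA wQ mul0mx.
  rewrite -{1}[w]hsubmxK tr_row_mx mul_row_col trmx1 mulmx1 => /rowP/(_ 0).
  rewrite !mxE => <-; congr (_ + _); apply: eq_bigr => j _.
  by rewrite !mxE.
pose i0 : 'I_n := Ordinal (ltnW n_ge2).
(* Evaluating the equation at two bases differing by exchanging [j] and [i0] equates the two
   coefficients. *)
have wc j : rsubmx w 0 j = rsubmx w 0 i0.
  have [-> //|ji] := eqVneq j i0.
  have [B1 [B2 [[B1M B2M [jB1 iB1]] B2E]]] := circuit_exchange ji (M_connected ji).
  have := wP _ (char_vec_zopoly R B1M); rewrite -(wP _ (char_vec_zopoly R B2M)).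
  move=> /addrI; rewrite B2E dot_exchange // -addrA -[LHS]addr0 => /addrI/esym.
  by rewrite addrC => /subr0_eq.
have wE : rsubmx w = rsubmx w 0 i0 *: const_mx 1.
  by apply/rowP => j; rewrite [RHS]mxE [const_mx _ _ _]mxE mulr1 wc.
have [B BM] := basesP M.
have : w = rsubmx w 0 i0 *: u.
  rewrite -{1}[w]hsubmxK /u scale_row_mx -wE; congr row_mx.
  apply/rowP => j; rewrite ord1 scale_scalar_mx !mxE mulr1n.
  have := wP _ (char_vec_zopoly R BM); rewrite {1}wE dotZl => /eqP.
  rewrite addr_eq0 mulrN => /eqP ->; congr (- (_ * _)).
    by rewrite mxE.
  rewrite dotC dot_char; under eq_bigr do rewrite mxE.
  by rewrite sumr_const (card_basis BM).
by move=> ->; apply: scalemx_sub.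
Qed.

Lemma affdimS_matroid_polytope : affdimS P = n.
Proof.
apply/eqP; rewrite eqn_leq affdimS_connected andbT.
exact: leq_trans (affdimS_sub matroid_polytope_hypersimplex) affdimS_hypersimplex_le.
Qed.

Lemma affdimS_hypersimplex : affdimS Delta = n.
Proof.
apply/eqP; rewrite eqn_leq affdimS_hypersimplex_le -{1}affdimS_matroid_polytope.
exact: affdimS_sub matroid_polytope_hypersimplex.
Qed.

Lemma affdimS_set0 : affdimS (set0 : set 'rV[R]_n) = 0%N.
Proof.
have [p [p0 _]] := affdimS_ex (set0 : set 'rV[R]_n).
by case: (affdimS _) p p0 => // k p /(_ ord0).
Qed.

Lemma facet_rank_equation Phi : facet P Phi ->
  exists S, [/\ S != finset.set0, S != [set: 'I_n]%SET &
    Phi = P `&` [set x | dot (char_vec R S) x = (rk M S)%:R]].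
Proof.
rewrite /facet affdimS_matroid_polytope => -[[c [b [Pb PhiE]]] dimPhi].
have Vb B : B \in bases M -> dot c (char_vec R B) <= b.
  by move=> BM; apply: Pb; apply: char_vec_zopoly.
have PhiV : Phi = zopoly R [set B in bases M | dot c (char_vec R B) == b]%SET.
  by rewrite PhiE -zopoly_face.
have maxB B : B \in bases M -> dot c (char_vec R B) = b -> forall S,
    (forall y z, y \in S -> z \notin S -> c 0 z < c 0 y) -> #|B :&: S| = rk M S.
  by move=> BM Bb S; apply: max_weight_basis => // B' /Vb; rewrite Bb.
have Phi_rk S : (forall y z, y \in S -> z \notin S -> c 0 z < c 0 y) ->
    forall x, Phi x -> dot (char_vec R S) x = (rk M S)%:R.
  move=> Sc x; rewrite PhiV; apply: zopoly_eq => B; rewrite inE => /andP[BM /eqP Bb].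
  by rewrite dot_char_char (maxB B).
have PhiT x : Phi x -> dot (char_vec R [set: 'I_n]%SET) x = d%:R.
  by rewrite PhiE dot_charT => -[/matroid_polytope_hypersimplex[]].
(* An empty [Phi] has [affdimS] 0, which would force [n = 1]. *)
have [B BM Bb] : exists2 B, B \in bases M & dot c (char_vec R B) = b.
  have [V0|[B]] := set_0Vmem [set B in bases M | dot c (char_vec R B) == b]%SET.
    suff Phi0 : Phi = set0.
      by exfalso; have := n_ge2; rewrite -[X in (1 < X)%N]dimPhi Phi0 affdimS_set0.
    rewrite PhiV V0; apply/seteqP; split=> // x /zopolyP[a [_ aV a1 _]].
    by have [B] := weight_support aV a1; rewrite inE.
  by rewrite inE => /andP[BM /eqP Bb]; exists B.
(* Three values would give two nested level sets which, with the whole ground set, form a chain of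
   three equations on [Phi]. *)
have two_values i j k : c 0 i < c 0 j -> c 0 j < c 0 k -> False.
  move=> ij jk.
  pose S1 := [set l | c 0 j < c 0 l]%SET; pose S2 := [set l | c 0 i < c 0 l]%SET.
  have := @affdimS_le_eq3 _ _ S1 S2 [set: 'I_n]%SET (rk M S1)%:R (rk M S2)%:R d%:R Phi.
  rewrite dimPhi ltnn; case/(_ _ _ _ _)/negP => //.
  - by apply/set0Pn; exists k; rewrite inE.
  - apply/properP; split; last by exists j; rewrite !inE ?ltxx.
    by apply/fintype.subsetP => l; rewrite !inE; apply: lt_trans.
  - by apply/properP; split; [exact: finset.subsetT|exists i; rewrite !inE ?ltxx].
  - move=> x Phix; split; last exact: PhiT.
      by apply: Phi_rk => // y z; rewrite !inE -leNgt => /[swap]; apply: le_lt_trans.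
    by apply: Phi_rk => // y z; rewrite !inE -leNgt => /[swap]; apply: le_lt_trans.
(* A constant [c] gives a form constant on the polytope, so [Phi] would be all of it. *)
have [[i [j ij]]|cst] := pselect (exists i j, c 0 j < c 0 i); last first.
  exfalso.
  have cE : c = c 0 (Ordinal (ltnW n_ge2)) *: char_vec R [set: 'I_n]%SET.
    apply/rowP => i; rewrite !mxE inE mulr1; apply/eqP; rewrite eq_le !leNgt.
    by apply/andP; split; apply/negP => h; apply: cst; eexists; eexists; exact: h.
  have PT x : P x -> dot c x = dot c (char_vec R B).
    move=> Px; rewrite cE !dotZl !dot_charT (matroid_polytope_hypersimplex Px).2.
    by rewrite (matroid_polytope_hypersimplex (char_vec_zopoly R BM)).2.
  move: dimPhi; suff -> : Phi = P.
    by rewrite affdimS_matroid_polytope => /eqP; rewrite gtn_eqF.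
  by rewrite PhiE; apply/seteqP; split=> [x []//|x Px]; split=> //; rewrite -Bb; apply: PT.
have cV k : c 0 k = c 0 i \/ c 0 k = c 0 j.
  case: (ltgtP (c 0 k) (c 0 i)) => [ki|ik|->]; [|by case: (two_values _ _ _ ij ik)|by left].
  case: (ltgtP (c 0 k) (c 0 j)) => [kj|jk|->]; [|by case: (two_values _ _ _ jk ki)|by right].
  by case: (two_values _ _ _ kj ij).
pose S : {set 'I_n} := [set k | c 0 k == c 0 i]%SET.
have jS : j \notin S by rewrite inE lt_eqF.
exists S; split.
- by apply/set0Pn; exists i; rewrite inE.
- by apply: contraNneq jS => ->; rewrite inE.
have Sc y z : y \in S -> z \notin S -> c 0 z < c 0 y.
  rewrite !inE => /eqP->; case: (cV z) => -> //; by rewrite eqxx.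
(* With two values, [c] combines the all-ones form, constant on the polytope, with the form of the
   upper level set [S] at a positive coefficient. *)
have cE : c = c 0 j *: char_vec R [set: 'I_n]%SET + (c 0 i - c 0 j) *: char_vec R S.
  apply/rowP => k; rewrite !mxE !inE mulr1; case: eqVneq => [->|ki].
    by rewrite mulr1 addrC subrK.
  by case: (cV k) => e; [rewrite e eqxx in ki|rewrite mulr0 addr0].
have PE x : P x -> dot c x = c 0 j * d%:R + (c 0 i - c 0 j) * dot (char_vec R S) x.
  move=> Px; rewrite {1}cE dotDl !dotZl dot_charT.
  by rewrite (matroid_polytope_hypersimplex Px).2.
have bE : b = c 0 j * d%:R + (c 0 i - c 0 j) * (rk M S)%:R.
  by rewrite -Bb PE ?dot_char_char ?(maxB B) //; apply: char_vec_zopoly.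
rewrite PhiE; apply/seteqP; split=> x [Px /= e]; split=> //=; move: e.
  rewrite -/(dot c x) PE // bE => /addrI/mulfI; apply.
  by rewrite subr_eq0 gt_eqF.
by move=> e; rewrite -/(dot c x) PE // bE e.
Qed.

(** A coordinate equation need not cut a facet out of the hypersimplex. Here it does, because the
    face contains [Phi], which already has the dimension of a facet. *)
Lemma coordinate_facet Phi i (e : bool) : facet P Phi ->
  Phi = P `&` [set x | dot (char_vec R [set i]%SET) x = e%:R] ->
  exists Psi, facet Delta Psi /\ Phi = P `&` Psi.
Proof.
move=> [_ dimPhi] PhiE.
exists (Delta `&` [set x | dot (char_vec R [set i]%SET) x = e%:R]); split; last first.
  rewrite PhiE setIA; congr (_ `&` _); apply/seteqP; split=> x; last by case.
  by move=> Px; split=> //; apply: matroid_polytope_hypersimplex.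
split.
  case: e PhiE => _; [exists (char_vec R [set i]%SET), 1|exists (- char_vec R [set i]%SET), 0].
    split=> // x [x01 _]; rewrite -/(dot _ _) dot_char1; by case/andP: (x01 i).
  have dotN x : dot (- char_vec R [set i]%SET) x = - x 0 i.
    by rewrite -scaleN1r dotZl mulN1r dot_char1.
  split=> [x [x01 _]|]; first by rewrite -/(dot _ _) dotN oppr_le0; case/andP: (x01 i).
  apply/seteqP; split=> x [Hx /=]; rewrite -/(dot _ _) ?dotN dot_char1 => xe; split=> //=.
    by rewrite xe oppr0.
  by apply/eqP; rewrite -oppr_eq0 xe.
apply/eqP; rewrite affdimS_hypersimplex eqn_leq; apply/andP; split.
  apply: (@affdimS_le_eq2 _ _ [set i]%SET [set: 'I_n]%SET e%:R d%:R).
  - by apply/set0Pn; exists i; rewrite inE.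
  - by rewrite properEcard finset.subsetT cardsT card_ord cards1.
  - by move=> x [[_ xd] xe]; rewrite dot_charT.
rewrite -[X in (X <= _)%N]affdimS_matroid_polytope -dimPhi ltnS; apply: affdimS_sub.
by rewrite PhiE => x [/matroid_polytope_hypersimplex].
Qed.

Lemma facet_cases Phi : facet P Phi ->
  (exists F, [/\ flat M F, (0 < rk M F < #|F|)%N, F != [set: 'I_n]%SET
     & Phi = P `&` [set x | dot (char_vec R F) x = (rk M F)%:R]]) \/
  (exists Psi, facet Delta Psi /\ Phi = P `&` Psi).
Proof.
move=> facetPhi; have [S [S0 ST PhiE]] := facet_rank_equation facetPhi.
have dimPhi : (affdimS Phi).+1 = n by rewrite facetPhi.2 affdimS_matroid_polytope.
have PhiV := matroid_polytope_face S; rewrite -PhiE in PhiV.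
have PhiT x : Phi x -> dot (char_vec R [set: 'I_n]%SET) x = d%:R.
  by rewrite PhiE dot_charT => -[/matroid_polytope_hypersimplex[]].
have PhiS x : Phi x -> dot (char_vec R S) x = (rk M S)%:R by rewrite PhiE => -[].
have no3 S1 S2 S3 (r1 r2 r3 : R) : S1 != finset.set0 -> S1 \proper S2 -> S2 \proper S3 ->
    (forall x, Phi x -> [/\ dot (char_vec R S1) x = r1, dot (char_vec R S2) x = r2
      & dot (char_vec R S3) x = r3]) -> False.
  by move=> h1 h2 h3 /(affdimS_le_eq3 h1 h2 h3); rewrite dimPhi ltnn.
have SpT S' : S' != [set: 'I_n]%SET -> S' \proper [set: 'I_n]%SET.
  by rewrite finset.properEneq finset.subsetT andbT.
(* If [i] outside [S] does not raise the rank, every basis of the facet avoids [i], hence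
   [x 0 i = 0] on [Phi]. *)
have [flatS|] := boolP (flat M S); last first.
  rewrite negb_forall => /existsP[i]; rewrite negb_imply -leqNgt => /andP[iS rki].
  have Phi_i x : Phi x -> dot (char_vec R [set i]%SET) x = 0.
    rewrite PhiV; apply: zopoly_eq => B; rewrite inE => /andP[BM /eqP BS].
    by rewrite dot_char1 mxE (negPf (basis_avoid BM BS iS rki)).
  have iSU x : dot (char_vec R (i |: S)%SET) x =
      dot (char_vec R [set i]%SET) x + dot (char_vec R S) x.
    by rewrite dot_char1 !dot_char big_setU1.
  (* Unless [i |: S] is the whole ground set, the chain [S], [i |: S], ground set is too long. If it
     is, [rk M S = d] and the rank equation amounts to [x 0 i = 0]. *)
  have [iST|/SpT iST] := eqVneq (i |: S)%SET [set: 'I_n]%SET; last first.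
    exfalso; apply: (no3 _ _ _ (rk M S)%:R (rk M S)%:R d%:R S0 _ iST).
      by rewrite finset.properUr // finset.sub1set.
    by move=> x Phix; rewrite iSU Phi_i // add0r; split; [apply: PhiS..|apply: PhiT].
  right; apply: (@coordinate_facet _ i false) => //.
  have rkd : rk M S = d.
    by apply/eqP; rewrite eqn_leq rkS ?finset.subsetT //= /matroid_rank -iST.
  rewrite PhiE rkd; apply/seteqP; split=> x [Px /= xe]; split=> //=; move: xe.
    by move=> xe; apply: Phi_i; rewrite PhiE rkd.
  have := (matroid_polytope_hypersimplex Px).2.
  by rewrite -dot_charT -iST iSU => + xe; rewrite xe add0r.
(* Rank 0 would put the whole polytope on the hyperplane where the coordinates in [S] sum to 0. *)
have [r0|rk_gt0] := posnP (rk M S).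
  exfalso; have := ltnn n; rewrite -{1}affdimS_matroid_polytope.
  case/negP; apply: (@affdimS_le_eq2 _ _ S _ 0 d%:R _ S0 (SpT _ ST)) => x Px.
  split; last by rewrite dot_charT; have [] := matroid_polytope_hypersimplex Px.
  apply: zopoly_eq Px => B BM; rewrite dot_char_char.
  by have := card_basisI_rk S BM; rewrite r0 leqn0 => /eqP ->.
have [rk_lt|rk_ge] := ltnP (rk M S) #|S|.
  by left; exists S; rewrite rk_gt0.
(* Now every basis of the facet contains [S], so [x 0 i = 1] on [Phi] for [i] in [S]; the chain
   [[set i]], [S], ground set then forces [S = [set i]]. *)
have /set0Pn[i iS] := S0.
have Phi_i x : Phi x -> dot (char_vec R [set i]%SET) x = 1.
  rewrite PhiV; apply: zopoly_eq => B; rewrite inE => /andP[BM /eqP BS].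
  have /eqP/finset.setIidPr/fintype.subsetP SB : (B :&: S == S)%SET.
    by rewrite eqEcard finset.subsetIr BS.
  by rewrite dot_char1 mxE SB.
have [Si|iS'] := eqVneq S [set i]%SET; last first.
  exfalso; apply: (no3 [set i]%SET S _ 1 (rk M S)%:R d%:R _ _ (SpT _ ST)).
  - by apply/set0Pn; exists i; rewrite inE.
  - by rewrite finset.properEneq finset.sub1set iS eq_sym iS'.
  - by move=> x Phix; split; [apply: Phi_i|apply: PhiS|apply: PhiT].
right; apply: (@coordinate_facet _ i true) => //.
have rk1 : rk M S = 1%N.
  apply/eqP; rewrite eqn_leq rk_gt0 andbT; have [B BM <-] := rk_basis M S.
  by rewrite Si (leq_trans (subset_leq_card (finset.subsetIr _ _))) ?cards1.
by rewrite PhiE rk1 Si.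
Qed.

(** Substituting the total [d] reduces the equation to [d] times the rank equation; cancelling [d]
    needs it to be nonzero. *)
Lemma flat_hyperplaneP F x : (0 < d)%N -> Delta x ->
  flat_hyperplane R M F x <-> dot (char_vec R F) x = (rk M F)%:R.
Proof.
move=> d_gt0 [_ xd]; rewrite /flat_hyperplane /= -dot_char.
have -> : \sum_(j | j \notin F) x 0 j = d%:R - dot (char_vec R F) x.
  rewrite -xd -(dot_charC F) addrAC subrr add0r dot_char.
  by apply: eq_bigl => j; rewrite inE.
have dN0 : d%:R != 0 :> R by rewrite pnatr_eq0 -lt0n.
rewrite mulrBl mulrBr; split=> [/addIr|->].
  by rewrite [RHS]mulrC => /(mulfI dN0).
by rewrite [_ * d%:R]mulrC.
Qed.

Lemma flat_facet_split Phi F : facet P Phi -> flat M F -> (rk M F < #|F|)%N ->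
  F != finset.set0 -> F != [set: 'I_n]%SET ->
  Phi = P `&` [set x | dot (char_vec R F) x = (rk M F)%:R] ->
  exists H, split_hyperplane Delta H /\ Phi = P `&` H.
Proof.
move=> [_ dimPhi] flatF rkF F0 FT PhiE.
have FpT : F \proper [set: 'I_n]%SET by rewrite finset.properEneq FT finset.subsetT.
pose L := Delta `&` [set x | dot (char_vec R F) x = (rk M F)%:R].
(* A proper flat gains rank from any element outside it. *)
have rd : (rk M F < d)%N.
  have /properP[_ [z _ zF]] := FpT.
  by have /forallP/(_ z)/implyP/(_ zF)/leq_trans := flatF; apply; apply: rkS (finset.subsetT _).
exists (aff_hull L); split; last first.
  rewrite PhiE; apply/seteqP; split=> x [Px xF]; split=> //.
    by apply: sub_aff_hull; split=> //; apply: matroid_polytope_hypersimplex.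
  by move: xF; apply: aff_hull_dot => y [].
apply: hypersimplex_split; first exact: ltnW.
(* If no point were strictly below, the whole polytope would satisfy the equation and lose a
   dimension. *)
- apply: contrapT => noless; have := ltnn n; rewrite -{1}affdimS_matroid_polytope.
  case/negP; apply: (@affdimS_le_eq2 _ _ F _ (rk M F)%:R d%:R _ F0 FpT) => x Px.
  have [Hx xF] := matroid_polytope_le F Px.
  split; last by rewrite dot_charT; case: Hx.
  by apply/eqP; rewrite eq_le xF leNgt; apply/negP => lt; apply: noless; exists x.
(* Swapping an element of a rank-attaining basis outside [F] for a missing element of [F] gives a
   [d]-set, not necessarily a basis, that lies strictly above. *)
- have [B BM BF] := rk_basis M F.
  have /fintype.subsetPn[y yF yB] : ~~ (F \subset B).
    by apply: contraL rkF => /finset.setIidPr FB; rewrite -BF FB ltnn.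
  have /fintype.subsetPn[z zB zF] : ~~ (B \subset F).
    by apply: contraL rd => /finset.setIidPl FB; rewrite -BF FB (card_basis BM) ltnn.
  exists (char_vec R (y |: (B :\ z))%SET).
    apply: hypersimplex_char_vec; rewrite cardsU1 !inE (negPf yB) andbF add1n.
    by rewrite -(card_basis BM) (cardsD1 z B) zB.
  by rewrite dot_exchange // dot_char_char BF !mxE yF (negPf zF) subr0 ltrDl.
- apply/eqP; rewrite affdimS_hypersimplex eqn_leq; apply/andP; split.
    apply: (@affdimS_le_eq2 _ _ F [set: 'I_n]%SET (rk M F)%:R d%:R) => // x [[_ xd] xF].
    by rewrite dot_charT.
  rewrite -[X in (X <= _)%N]affdimS_matroid_polytope -dimPhi ltnS; apply: affdimS_sub.
  by rewrite PhiE => x [/matroid_polytope_hypersimplex].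
Qed.

End MatroidPolytopeFacets.

Theorem proposition7 (R : realType) (n d : nat) (M : matroid n)
    (n_ge2 : (2 <= n)%N) (rank_M : matroid_rank M = d)
    (M_connected : matroid_connected M) :
  (forall Phi : set 'rV[R]_n, facet (matroid_polytope R M) Phi ->
     (exists F : {set 'I_n}, [/\ flat M F, (0 < rk M F < #|F|)%N
        & Phi = matroid_polytope R M `&` flat_hyperplane R M F]) \/
     (exists Psi : set 'rV[R]_n, facet (hypersimplex R n d) Psi /\
        Phi = matroid_polytope R M `&` Psi)) /\
  (forall Phi : set 'rV[R]_n, facet (matroid_polytope R M) Phi ->
     (exists H : set 'rV[R]_n, split_hyperplane (hypersimplex R n d) H /\
        Phi = matroid_polytope R M `&` H) \/
     (exists Psi : set 'rV[R]_n, facet (hypersimplex R n d) Psi /\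
        Phi = matroid_polytope R M `&` Psi)).
Proof.
rewrite -rank_M; split=> Phi facetPhi.
  have [[F [flatF rkF FT ->]]|] := facet_cases n_ge2 M_connected facetPhi; last by right.
  left; exists F; split=> //; have /andP[rk_gt0 _] := rkF.
  (* The rank [d] is at least the positive rank of [F]. *)
  have d_gt0 : (0 < matroid_rank M)%N.
    exact: leq_trans rk_gt0 (rkS _ (finset.subsetT _)).
  apply/seteqP; split=> x [Px] /(flat_hyperplaneP F d_gt0 (matroid_polytope_hypersimplex Px)) xF;
    by split.
have [[F [flatF /andP[rk_gt0 rk_lt] FT PhiE]]|] := facet_cases n_ge2 M_connected facetPhi; last by right.
left; apply: (flat_facet_split n_ge2 M_connected facetPhi flatF rk_lt _ FT PhiE).
by rewrite -card_gt0 (leq_trans _ rk_lt).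
Qed.
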